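(* Let $\lambda^{(\epsilon)}$ and $\mu$ satisfy the heavy-traffic assumption and let $M$ be any menu admissible for $(\lambda^{(\epsilon)},\mu)$, with CRP components $\mathbb{C}_1,\dots,\mathbb{C}_K$ and limiting scaled mean waiting times $\widehat W_{\mathbb{C}_k}$. Then $$\widehat W_{\mathbb{C}_k}\ge\frac1{|\gamma|}\qquad\text{for all }k\in[K].$$ Furthermore, for $k\in[K]$, $\widehat W_{\mathbb{C}_k}=\frac1{|\gamma|}$ if and only if there exists a directed path in the DAG $\mathcal{D}$ of $M$ from $\mathbb{C}_k$ to every other CRP component $\mathbb{C}_\kappa$, $\kappa\in[K]\setminus\{k\}$ (a condition trivially satisfied if there is only one CRP component).
   Context: Model. There are $n$ customer classes and $m$ servers; $[k]=\{1,\dots,k\}$, $|x|=\sum_i x_i$. A menu is a matrix $M=[m_{ij}]\in\{0,1\}^{n\times m}$; class $i$ can be served by server $j$ iff $m_{ij}=1$. Class $i$ customers arrive as Poisson processes of rate $\lambda_i$, server $j$ serves at exponential rate $\mu_j>0$, and the discipline is FCFS with assignment of an arriving customer to the longest-idle compatible server (FCFS-ALIS). Heavy traffic. $\lambda_i^{(\epsilon)}=\Lambda_i-\gamma_i\epsilon+o(\epsilon)\ge 0$ for $i\in[n]$, $0<\epsilon<\epsilon_+$, with $\Lambda\in\mathbb{R}_{\ge0}^n$, $\gamma\in\mathbb{R}^n$. Heavy-traffic assumption: $|\Lambda|=|\mu|$; $|\gamma|>0$; $\gamma_i<0$ whenever $\Lambda_i=0$. Admissibility. For $S\subseteq[m]$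 let $U_S(M)=\{i\in[n]:\sum_{j\notin S}m_{ij}=0\}$ and $\Delta^{(\epsilon)}_S(M)=\sum_{j\in S}\mu_j-\sum_{i\in U_S(M)}\lambda_i^{(\epsilon)}$. $M$ is admissible if for every nonempty $S\subseteq[m]$, $\Delta^{(\epsilon)}_S(M)=\Omega(\epsilon)$ (bounded below by $c\epsilon$, some $c>0$, for small $\epsilon>0$), and every class with no compatible server has zero arrival rate. Residual matching and CRP components. $\mathcal{F}(0,\Lambda,M)$ is the set of $f=[f_{ij}]\ge0$ with $\sum_i f_{ij}\le\mu_j$, $\sum_j f_{ij}=\Lambda_i$, and $f_{ij}=0$ whenever $m_{ij}=0$. The residual matching $\breve M$ has $\breve m_{ij}=1$ iff some $f\in\mathcal{F}(0,\Lambda,M)$ has $f_{ij}>0$. The CRP components $\mathbb{C}_k=(\mathcal{C}_k,\mathcal{S}_k)$, $k\in[K]$, are the connected components of the bipartite graph of $\breve M$ (classes $\mathcal{C}_k$, servers $\mathcal{S}_k$). Each class with $\Lambda_i=0$ is a component by itself with no servers. Let $\widetilde\Lambda_k=\sum_{i\in\mathcal{C}_k}\Lambda_i$, $\widetilde\gamma_k=\sum_{i\in\mathcal{C}_k}\gamma_i$, $\mathcal{I}_0=\{k:\widetilde\Lambda_k=0\}$, $K'=K-|\mathcal{I}_0|$; indexing is such that $[K]\setminus\mathcal{I}_0=[K']$. DAG. $\mathcal{D}$ is the directed acyclic graph on $[K]$ with an arc $(k_1,k_2)$, $k_1\ne k_2$, iff $m_{ij}=1$ for some $i\in\mathcal{C}_{k_1}$,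 $j\in\mathcal{S}_{k_2}$; $k_1\rightsquigarrow k_2$ means there is a directed path. $\mathcal{T}(\mathcal{D},K')=\{\sigma_1,\dots,\sigma_T\}$ is the set of permutations $\sigma$ of $[K']$ such that $k_1\rightsquigarrow k_2$ implies $\sigma^{-1}(k_2)<\sigma^{-1}(k_1)$. For $k\in[K']$, $\mathrm{comps}(\sigma,k)=\{\sigma(k)\}\cup\{\kappa\in\mathcal{I}_0:k=\max\{k'\in[K']:\kappa\rightsquigarrow\sigma(k')\}\}$; $\mathrm{comps}^{-1}(\sigma,k)$ is the $\kappa\in[K']$ with $k\in\mathrm{comps}(\sigma,\kappa)$; $\widetilde\gamma_{\mathrm{comps}(\sigma,\ell)}=\sum_{\kappa\in\mathrm{comps}(\sigma,\ell)}\widetilde\gamma_\kappa$. With $$\mathbb{Q}(\sigma)=\prod_{\kappa\in[K']}\frac1{\sum_{\ell=1}^{\kappa}\widetilde\gamma_{\mathrm{comps}(\sigma,\ell)}},\qquad w_{\sigma,k}=\sum_{\kappa=\mathrm{comps}^{-1}(\sigma,k)}^{K'}\frac1{\sum_{\ell=1}^{\kappa}\widetilde\gamma_{\mathrm{comps}(\sigma,\ell)}},$$ the limiting scaled (by $\epsilon$) steady-state mean waiting time of every class in $\mathbb{C}_k$ is $\widehat W_{\mathbb{C}_k}=\sum_{t}\frac{\mathbb{Q}(\sigma_t)}{\sum_{s}\mathbb{Q}(\sigma_s)}w_{\sigma_t,k}$.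
   Formalization: In the equality criterion, paths from C_k are required only to the other components with positive limiting arrival rate (outside I_0); zero-rate components have no servers, so no arc enters them and the literal ''only if'' fails. *)

(* Defs.v *)
(* MathComp-Analysis, over an arbitrary R : realType *)
From HB Require Import structures.
From mathcomp Require Import all_boot all_order all_algebra perm.
From mathcomp Require Import all_classical all_reals all_analysis.

Set Implicit Arguments.
Unset Strict Implicit.
Unset Printing Implicit Defensive.

Import Order.TTheory GRing.Theory Num.Theory.
Import numFieldNormedType.Exports.

Local Open Scope set_scope.
Local Open Scope ring_scope.

(* A menu is M : 'M[bool]_(n, m); the index sets [n], [m], [K] are the 0-based
   'I_n, 'I_m, 'I_K. The family lam e i is the arrival rate lambda_i^(e); only
   its values for 0 < e < ep matter. *)

Definition heavy_traffic (R : realType) (n m : nat) (ep : R)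
    (lam : R -> 'I_n -> R) (mu : 'I_m -> R) (Lam gam : 'I_n -> R) : Prop :=
  [/\ (0 < ep) /\ (forall i (e : R), 0 < e < ep -> 0 <= lam e i),
      (forall i, 0 <= Lam i) /\
        (forall i (e : R),
           lam e i = Lam i - gam i * e +o_(e \near (0^'+)%classic) e),
      \sum_i Lam i = \sum_j mu j,
      0 < \sum_i gam i
    & forall i, Lam i = 0 -> gam i < 0].

(* U_S(M): the classes whose compatible servers all lie in S. *)
Definition captive (n m : nat) (M : 'M[bool]_(n, m)) (S : {set 'I_m}) :
    {set 'I_n} :=
  [set i | (\sum_(j | j \notin S) M i j == 0)%N].

Definition slack (R : realType) (n m : nat) (lam : R -> 'I_n -> R)
    (mu : 'I_m -> R) (M : 'M[bool]_(n, m)) (S : {set 'I_m}) (e : R) : R :=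
  \sum_(j in S) mu j - \sum_(i in captive M S) lam e i.

(* The lower bound is one-sided, so it is not the library's =Omega, which
   compares norms. *)
Definition admissible (R : realType) (n m : nat) (ep : R)
    (lam : R -> 'I_n -> R) (mu : 'I_m -> R) (M : 'M[bool]_(n, m)) : Prop :=
  (forall S : {set 'I_m}, S != finset.set0 ->
     exists2 c : R, 0 < c &
       \forall e \near (0^'+)%classic, c * e <= slack lam mu M S e) /\
  (forall i, (forall j, ~~ M i j) -> forall e : R, 0 < e < ep -> lam e i = 0).

(* f \in F(0, Lam, M) *)
Definition feasible_flow (R : realType) (n m : nat) (mu : 'I_m -> R)
    (Lam : 'I_n -> R) (M : 'M[bool]_(n, m)) (f : 'M[R]_(n, m)) : Prop :=
  [/\ forall i j, 0 <= f i j,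
      forall j, \sum_i f i j <= mu j,
      forall i, \sum_j f i j = Lam i
    & forall i j, ~~ M i j -> f i j = 0].

Definition residual_matching (R : realType) (n m : nat) (mu : 'I_m -> R)
    (Lam : 'I_n -> R) (M : 'M[bool]_(n, m)) : 'M[bool]_(n, m) :=
  \matrix_(i, j) `[< exists2 f, feasible_flow mu Lam M f & 0 < f i j >].

(* The bipartite graph of a menu: classes are the inl vertices, servers the inr
   vertices. *)
Definition bip_rel (n m : nat) (M : 'M[bool]_(n, m)) : rel ('I_n + 'I_m) :=
  fun u v => match u, v with
             | inl i, inr j => M i j
             | inr j, inl i => M i j
             | _, _ => false
             end.

Definition crp_components (R : realType) (n m : nat) (mu : 'I_m -> R)
    (Lam : 'I_n -> R) (M : 'M[bool]_(n, m)) : {set {set 'I_n + 'I_m}} :=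
  equivalence_partition (connect (bip_rel (residual_matching mu Lam M)))
    [set: 'I_n + 'I_m].

(* Below, comp : 'I_K -> {set 'I_n + 'I_m} is an indexing of the components. *)

Definition comp_classes (n m K : nat) (comp : 'I_K -> {set 'I_n + 'I_m})
    (k : 'I_K) : {set 'I_n} := [set i | inl i \in comp k].

Definition comp_servers (n m K : nat) (comp : 'I_K -> {set 'I_n + 'I_m})
    (k : 'I_K) : {set 'I_m} := [set j | inr j \in comp k].

(* comp_sum Lam comp k and comp_sum gam comp k are the aggregates
   \tilde\Lambda_k and \tilde\gamma_k. *)
Definition comp_sum (R : realType) (n m K : nat) (x : 'I_n -> R)
    (comp : 'I_K -> {set 'I_n + 'I_m}) (k : 'I_K) : R :=
  \sum_(i in comp_classes comp k) x i.

(* For an admissible menu under heavy traffic, a component in I0 is a single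
   class with no server, so no arc of the DAG enters it. *)
Definition I0 (R : realType) (n m K : nat) (Lam : 'I_n -> R)
    (comp : 'I_K -> {set 'I_n + 'I_m}) : {set 'I_K} :=
  [set k | comp_sum Lam comp k == 0].

Definition K' (R : realType) (n m K : nat) (Lam : 'I_n -> R)
    (comp : 'I_K -> {set 'I_n + 'I_m}) : nat := (K - #|I0 Lam comp|)%N.

(* The inclusion of [K'] in [K]. *)
Definition emb (R : realType) (n m K : nat) (Lam : 'I_n -> R)
    (comp : 'I_K -> {set 'I_n + 'I_m}) : 'I_(K' Lam comp) -> 'I_K :=
  widen_ord (leq_subr #|I0 Lam comp| K).

(* comp enumerates the CRP components without repetition, in such a way that
   [K] \ I0 = [K']. *)
Definition crp_indexing (R : realType) (n m K : nat) (mu : 'I_m -> R)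
    (Lam : 'I_n -> R) (M : 'M[bool]_(n, m))
    (comp : 'I_K -> {set 'I_n + 'I_m}) : Prop :=
  [/\ injective comp,
      [set comp k | k : 'I_K] = crp_components mu Lam M
    & forall k : 'I_K, (k \notin I0 Lam comp) = (k < K' Lam comp)%N].

Definition dag_arc (n m K : nat) (M : 'M[bool]_(n, m))
    (comp : 'I_K -> {set 'I_n + 'I_m}) : rel 'I_K :=
  fun k1 k2 => (k1 != k2) &&
    [exists i in comp_classes comp k1, exists j in comp_servers comp k2, M i j].

(* k1 ~> k2. The path must have at least one arc, whereas connect is
   reflexive. *)
Definition dpath (n m K : nat) (M : 'M[bool]_(n, m))
    (comp : 'I_K -> {set 'I_n + 'I_m}) : rel 'I_K :=
  fun k1 k2 => [exists k, dag_arc M comp k1 k && connect (dag_arc M comp) k k2].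

(* T(D, K') *)
Definition topo_orders (R : realType) (n m K : nat) (Lam : 'I_n -> R)
    (M : 'M[bool]_(n, m)) (comp : 'I_K -> {set 'I_n + 'I_m}) :
    {set {perm 'I_(K' Lam comp)}} :=
  [set s : {perm 'I_(K' Lam comp)} |
    [forall k1, forall k2, dpath M comp (emb k1) (emb k2) ==>
       ((s^-1)%g k2 < (s^-1)%g k1)%N]].

Definition comps (R : realType) (n m K : nat) (Lam : 'I_n -> R)
    (M : 'M[bool]_(n, m)) (comp : 'I_K -> {set 'I_n + 'I_m})
    (s : {perm 'I_(K' Lam comp)}) (k : 'I_(K' Lam comp)) : {set 'I_K} :=
  emb (s k) |:
    [set kap in I0 Lam comp | dpath M comp kap (emb (s k)) &&
       [forall k', dpath M comp kap (emb (s k')) ==> (k' <= k)%N]].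

(* The position of the block containing k. When M is admissible under heavy
   traffic this block exists and is unique, so None does not occur. *)
Definition comps_inv (R : realType) (n m K : nat) (Lam : 'I_n -> R)
    (M : 'M[bool]_(n, m)) (comp : 'I_K -> {set 'I_n + 'I_m})
    (s : {perm 'I_(K' Lam comp)}) (k : 'I_K) : option 'I_(K' Lam comp) :=
  [pick kap | k \in comps M s kap].

(* The sum over l = 1..kap of \tilde\gamma_{comps(s, l)}. *)
Definition gam_partial (R : realType) (n m K : nat) (Lam gam : 'I_n -> R)
    (M : 'M[bool]_(n, m)) (comp : 'I_K -> {set 'I_n + 'I_m})
    (s : {perm 'I_(K' Lam comp)}) (kap : 'I_(K' Lam comp)) : R :=
  \sum_(l : 'I_(K' Lam comp) | (l <= kap)%N)
     \sum_(k in comps M s l) comp_sum gam comp k.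

Definition Qsigma (R : realType) (n m K : nat) (Lam gam : 'I_n -> R)
    (M : 'M[bool]_(n, m)) (comp : 'I_K -> {set 'I_n + 'I_m})
    (s : {perm 'I_(K' Lam comp)}) : R :=
  \prod_(kap : 'I_(K' Lam comp)) (1 / gam_partial gam M s kap).

Definition wsigma (R : realType) (n m K : nat) (Lam gam : 'I_n -> R)
    (M : 'M[bool]_(n, m)) (comp : 'I_K -> {set 'I_n + 'I_m})
    (s : {perm 'I_(K' Lam comp)}) (k : 'I_K) : R :=
  if comps_inv M s k is Some kap0 then
    \sum_(kap : 'I_(K' Lam comp) | (kap0 <= kap)%N)
       (1 / gam_partial gam M s kap)
  else 0.

(* The limiting scaled steady-state mean waiting time of the classes in the
   k-th component. *)
Definition What (R : realType) (n m K : nat) (Lam gam : 'I_n -> R)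
    (M : 'M[bool]_(n, m)) (comp : 'I_K -> {set 'I_n + 'I_m}) (k : 'I_K) : R :=
  \sum_(s in topo_orders Lam M comp)
     Qsigma gam M s / (\sum_(s' in topo_orders Lam M comp) Qsigma gam M s')
       * wsigma gam M s k.

(* Main.v *)
Require Import Defs.
From HB Require Import structures.
From mathcomp Require Import all_boot all_order all_algebra perm.
From mathcomp Require Import all_classical all_reals all_analysis.
From mathcomp Require Import lra.
Import Order.TTheory GRing.Theory Num.Theory.
Import numFieldNormedType.Exports.
Local Open Scope ring_scope.

(** Fix a topological order [s] and a position [l], and let [S] be the set of
    servers of the blocks of [s] up to position [l].  The classes all of whose compatible
    servers lie in [S] are exactly the classes of these blocks
    ([captive_prefix]), and the limiting rates balance on a union of components
    ([balance]), so [S] has limiting slack 0; admissibility then forces its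
    first-order slack, which is [gam_partial gam M s l], to be positive
    ([gam_captive_gt0], [gam_partial_gt0]).  Hence the weights [Qsigma] are
    positive, and [wsigma gam M s k] is a sum of positive terms that always
    includes the term of the last position, namely [1 / \sum_i gam i].  This is
    the lower bound.  Equality for [s] means that [k] lies in the last block
    of [s] ([wsigma_eq]), so equality for [What], an average with positive
    weights, means that [k] lies in the last block of every topological order.
    If [k] reaches every other component with positive rate, this is clear.  If
    it misses one, some topological order lists all components reachable from
    [k] before the missed one, and [k] is not in its last block
    ([all_last_reach]).

    Two facts about flows are needed.  A feasible flow exists: letting the
    perturbation tend to 0 in the admissibility condition gives Hall's condition
    for the limiting rates ([hall_limit]), and Hall's theorem for real weights
    ([hall_flow]) gives a flow.  The graph on the components is acyclic
    ([dpath_irr]), without which there would be no topological order: tight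
    sets, where Hall's condition is an equality, are closed under residual edges
    and under arcs, and a compatible pair whose class has positive rate and
    is captive in every tight set containing its server is a residual edge
    ([residual_of_tight]); thus an arc on a cycle would be a residual edge, and
    would join two vertices of the same component. *)

(** * Hall's theorem with real weights *)

Section Hall.
Import mathcomp.boot.fintype mathcomp.boot.finset.
Local Open Scope set_scope.
Variables (R : realType) (n m : nat) (M : 'M[bool]_(n, m)).
Implicit Types (a : 'I_n -> R) (b : 'I_m -> R) (S T : {set 'I_m}).

(** Membership in the set of classes all of whose compatible servers are in [S]. *)
Lemma captiveP S i : reflect (forall j, M i j -> j \in S) (i \in captive M S).
Proof.
rewrite inE sum_nat_eq0; apply: (iffP forallP) => [h j Mij|h j].
  by move: (h j); case: (j \in S) => //=; rewrite Mij.
by apply/implyP => jS; case Mij: (M i j) => //; rewrite (h _ Mij) in jS.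
Qed.

Lemma captiveI S T : captive M (S :&: T) = captive M S :&: captive M T.
Proof.
apply/setP => i; rewrite in_setI; apply/captiveP/andP.
  move=> h; split; apply/captiveP => j /h; by rewrite in_setI => /andP[].
move=> [/captiveP hS /captiveP hT] j Mij.
by rewrite in_setI hS ?hT.
Qed.

Lemma captive_sub S T : S \subset T -> captive M S \subset captive M T.
Proof.
move=> sST; apply/subsetP => i /captiveP h; apply/captiveP => j /h.
exact: (subsetP sST).
Qed.

(** Hall's condition for supplies [a] of the classes and capacities [b] of the
    servers, stated with sets of servers rather than sets of classes. *)
Definition hall a b :=
  forall S, \sum_(i in captive M S) a i <= \sum_(j in S) b j.

Lemma feasible_flowD a1 a2 b1 b2 f1 f2 :
  feasible_flow b1 a1 M f1 -> feasible_flow b2 a2 M f2 ->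
  feasible_flow (fun j => b1 j + b2 j) (fun i => a1 i + a2 i) M (f1 + f2).
Proof.
move=> [p1 c1 r1 z1] [p2 c2 r2 z2]; split.
- by move=> i j; rewrite mxE addr_ge0.
- by move=> j; under eq_bigr do rewrite mxE; rewrite big_split lerD.
- by move=> i; under eq_bigr do rewrite mxE; rewrite big_split r1 r2.
- by move=> i j Mij; rewrite mxE z1 ?z2 ?addr0.
Qed.

Lemma sum_if_in (I : finType) (A B : {set I}) (x : I -> R) :
  \sum_(i in A) (if i \in B then x i else 0) = \sum_(i in A :&: B) x i.
Proof. by rewrite -big_mkcondr; apply: eq_bigl => i; rewrite inE. Qed.

(** Hall's condition survives restriction to a set of servers and the classes
    captive in it. *)
Lemma hall_inside a b S : hall a b ->
  hall (fun i => if i \in captive M S then a i else 0)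
       (fun j => if j \in S then b j else 0).
Proof. by move=> H T; rewrite !sum_if_in -captiveI. Qed.

(** For a tight set it also survives restriction to the complement. *)
Lemma hall_outside a b S : (forall i, 0 <= a i) -> hall a b ->
  \sum_(i in captive M S) a i = \sum_(j in S) b j ->
  hall (fun i => if i \in ~: captive M S then a i else 0)
       (fun j => if j \in ~: S then b j else 0).
Proof.
move=> a0 H tight T; rewrite !sum_if_in -!setDE.
have := H (T :|: S).
rewrite [leRHS](big_setID S) [leLHS](big_setID (captive M S)) /=.
rewrite (setIidPr (captive_sub _ _ (subsetUr _ _))) (setIidPr (subsetUr _ _)).
rewrite tight lerD2l setDUl setDv setU0.
apply: le_trans.
have sub: captive M T :\: captive M S \subset captive M (T :|: S) :\: captive M S.
  by apply: setSD; apply: captive_sub; apply: subsetUl.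
rewrite [leRHS](big_setID (captive M T :\: captive M S)) /= (setIidPr sub).
by rewrite lerDl sumr_ge0.
Qed.

(** The largest [d] below [x] and all [F t] with [P t] attains one of these
    bounds. *)
Lemma exists_maximal_bound (T : finType) (P : pred T) (F : T -> R) (x : R) :
  exists d, [/\ d <= x, forall t, P t -> d <= F t &
    d = x \/ exists2 t, P t & d = F t].
Proof.
case: (pickP P) => [t0 Pt0|P0]; last first.
  by exists x; split=> //; [move=> t; rewrite P0 | left].
case: (arg_minP F Pt0) => t Pt tmin.
exists (Num.min x (F t)); split.
- by rewrite ge_min lexx.
- by move=> u Pu; rewrite ge_min tmin ?orbT.
- by case: (leP x (F t)) => _; [left | right; exists t].
Qed.

Lemma sum_sub_delta (I : finType) (A : {set I}) (x : I -> R) (i0 : I) d :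
  \sum_(i in A) (x i - (if i == i0 then d else 0)) =
  \sum_(i in A) x i - (if i0 \in A then d else 0).
Proof.
rewrite sumrB; congr (_ - _); rewrite -big_mkcondr /=.
case: ifPn => h; last first.
  by rewrite big_pred0 // => i; apply/andP => -[iA /eqP e]; rewrite -e iA in h.
rewrite (big_pred1 i0) // => i; rewrite /= andbC.
by case: eqP => // ->.
Qed.

Lemma sum_delta (I : finType) (i0 : I) (d : R) :
  \sum_i (if i == i0 then d else 0) = d.
Proof. by rewrite -big_mkcond big_pred1_eq. Qed.

Lemma feasible_flow_delta i0 j0 (d : R) : 0 <= d -> M i0 j0 ->
  feasible_flow (fun j => if j == j0 then d else 0)
                (fun i => if i == i0 then d else 0) M
    (\matrix_(i, j) if (i == i0) && (j == j0) then d else 0).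
Proof.
move=> d0 M0; split.
- by move=> i j; rewrite mxE; case: ifP.
- move=> j; under eq_bigr do rewrite mxE.
  case: (j == j0); first by under eq_bigr do rewrite andbT; rewrite sum_delta.
  by rewrite big1 // => i _; rewrite andbF.
- move=> i; under eq_bigr do rewrite mxE.
  case: (i == i0); first by rewrite sum_delta.
  by rewrite big1.
- move=> i j Mij; rewrite mxE; case: ifP => // /andP[/eqP ei /eqP ej].
  by rewrite ei ej M0 in Mij.
Qed.

Lemma feasible_flow_ext a a' b b' f : a =1 a' -> b =1 b' ->
  feasible_flow b a M f -> feasible_flow b' a' M f.
Proof.
by move=> ea eb [p c r z]; split=> // [j|i]; rewrite -?eb -?ea.
Qed.

Lemma card_pos_le (I : finType) (x y : I -> R) :
  (forall i, 0 < y i -> 0 < x i) ->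
  (#|[set i | (0 < y i)%R]| <= #|[set i | (0 < x i)%R]|)%N.
Proof.
by move=> h; apply: subset_leq_card; apply/subsetP => i; rewrite !inE => /h.
Qed.

Lemma card_pos_lt (I : finType) (x y : I -> R) i0 :
  (forall i, 0 < y i -> 0 < x i) -> 0 < x i0 -> y i0 <= 0 ->
  (#|[set i | (0 < y i)%R]| < #|[set i | (0 < x i)%R]|)%N.
Proof.
move=> h x0 y0; apply: proper_card; apply/properP; split.
  by apply/subsetP => i; rewrite !inE => /h.
by exists i0; rewrite !inE // -leNgt.
Qed.

(** By induction on the number of positive supplies and capacities: send as much
    flow as Hall's condition allows along one edge with positive endpoints.
    Then either an endpoint is exhausted, or some set of servers containing the
    server but not capturing the class has become tight, and the problem splits
    into two smaller ones, inside and outside that set. *)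
Theorem hall_flow a b : (forall i, 0 <= a i) -> (forall j, 0 <= b j) ->
  hall a b -> exists f, feasible_flow b a M f.
Proof.
have [N] := ubnP (#|[set i | (0 < a i)%R]| + #|[set j | (0 < b j)%R]|)%N.
elim: N a b => // N IH a b; rewrite ltnS => leN a0 b0 H.
case: (pickP (fun i => 0 < a i)) => [i0 ai0|az]; last first.
  exists 0; split=> [i j|j|i|i j _]; rewrite ?mxE //.
    by rewrite big1 // => i _; rewrite mxE.
  rewrite big1 => [|j _]; last by rewrite mxE.
  by apply/eqP; rewrite eq_le a0 andTb leNgt az.
(* otherwise the servers without capacity would capture [i0] *)
have [j0 M0 bj0]: exists2 j0, M i0 j0 & 0 < b j0.
  case: (pickP (fun j => M i0 j && (0 < b j))) => [j /andP[]|nb]; first by exists j.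
  have := H [set j | b j <= 0].
  have i0c : i0 \in captive M [set j | b j <= 0].
    by apply/captiveP => j Mij; have := nb j; rewrite Mij inE leNgt /= => ->.
  rewrite (bigD1 i0) //= leNgt => /negP[].
  apply: (@le_lt_trans _ _ 0).
    by apply: sumr_le0 => j; rewrite inE.
  by apply: ltr_wpDr => //; apply: sumr_ge0.
pose P S := (j0 \in S) && (i0 \notin captive M S).
pose F S := \sum_(j in S) b j - \sum_(i in captive M S) a i.
(* [d] is the largest amount that preserves Hall's condition *)
have [d [dx dF dE]] := exists_maximal_bound _ P F (Num.min (a i0) (b j0)).
have [da db] : d <= a i0 /\ d <= b j0 by move: dx; rewrite le_min => /andP.
have d0 : 0 <= d.
  case: dE => [->|[S _ ->]]; first by rewrite le_min !ltW.
  by rewrite subr_ge0.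
pose a' i := a i - (if i == i0 then d else 0).
pose b' j := b j - (if j == j0 then d else 0).
have a'0 i : 0 <= a' i by rewrite subr_ge0; case: eqP => // ->.
have b'0 j : 0 <= b' j by rewrite subr_ge0; case: eqP => // ->.
have a'a i : a' i <= a i by rewrite gerBl; case: eqP.
have b'b j : b' j <= b j by rewrite gerBl; case: eqP.
have H' : hall a' b'.
  move=> S; rewrite !sum_sub_delta.
  have HS := H S; have := dF S; rewrite /P /F.
  by case: (j0 \in S); case: (i0 \in captive M S) => /= h;
     try (have {}h := h isT); lra.
suff [f tf] : exists f, feasible_flow b' a' M f.
  exists (f + \matrix_(i, j) if (i == i0) && (j == j0) then d else 0).
  apply: feasible_flow_ext (feasible_flowD _ _ _ _ _ _ tf
    (feasible_flow_delta _ _ _ d0 M0)).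
    by move=> i; rewrite subrK.
  by move=> j; rewrite subrK.
have posa i : 0 < a' i -> 0 < a i by move/lt_le_trans; apply.
have posb j : 0 < b' j -> 0 < b j by move/lt_le_trans; apply.
(* either an endpoint of the edge is exhausted or a set has become tight *)
have [a'i0|[b'j0|[S /andP[j0S i0S] tight]]] : a' i0 <= 0 \/ b' j0 <= 0 \/
    exists2 S, P S & \sum_(i in captive M S) a' i = \sum_(j in S) b' j.
  case: dE => [dE|[S PS dE]]; last first.
    right; right; exists S => //; rewrite !sum_sub_delta.
    by case/andP: PS => -> /negPf ->; rewrite dE /F; lra.
  rewrite /a' /b' !eqxx; move: dE; case: (leP (a i0) (b j0)) => _ ->.
    by left; rewrite subrr.
  by right; left; rewrite subrr.
- apply: IH => //; apply: leq_trans leN.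
  by rewrite -addSn leq_add ?card_pos_le //; apply: card_pos_lt ai0 _.
- apply: IH => //; apply: leq_trans leN.
  by rewrite -addnS leq_add ?card_pos_le //; apply: card_pos_lt bj0 _.
- have [f1 t1] : exists f,
      feasible_flow (fun j => if j \in S then b' j else 0)
        (fun i => if i \in captive M S then a' i else 0) M f.
    apply: IH; last exact: hall_inside.
    + apply: leq_trans leN; rewrite -addSn leq_add //.
        apply: card_pos_lt ai0 _; last by rewrite (negPf i0S).
        by move=> i; case: ifP => [_ /posa|_]; rewrite ?ltxx.
      by apply: card_pos_le => j; case: ifP => [_ /posb|_]; rewrite ?ltxx.
    + by move=> i; case: ifP.
    + by move=> j; case: ifP.
  have [f2 t2] : exists f,
      feasible_flow (fun j => if j \in ~: S then b' j else 0)
        (fun i => if i \in ~: captive M S then a' i else 0) M f.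
    apply: IH; last exact: hall_outside.
    + apply: leq_trans leN; rewrite -addnS leq_add //.
        by apply: card_pos_le => i; case: ifP => [_ /posa|_]; rewrite ?ltxx.
      apply: card_pos_lt bj0 _; last by rewrite inE j0S.
      by move=> j; case: ifP => [_ /posb|_]; rewrite ?ltxx.
    + by move=> i; case: ifP.
    + by move=> j; case: ifP.
  exists (f1 + f2); apply: feasible_flow_ext (feasible_flowD _ _ _ _ _ _ t1 t2).
    by move=> i; rewrite in_setC; case: ifP => _ /=; rewrite ?addr0 ?add0r.
  by move=> j; rewrite in_setC; case: ifP => _ /=; rewrite ?addr0 ?add0r.
Qed.

End Hall.

Arguments hall {R n m} M a b.

(** * The limiting rates of an admissible menu *)

Section Limits.
Import mathcomp.boot.fintype mathcomp.boot.finset.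
Local Open Scope set_scope.
Variables (R : realType) (n m : nat) (ep : R) (lam : R -> 'I_n -> R).
Variables (mu : 'I_m -> R) (Lam gam : 'I_n -> R) (M : 'M[bool]_(n, m)).
Hypothesis HT : heavy_traffic ep lam mu Lam gam.
Hypothesis adm : admissible ep lam mu M.

(** Arbitrarily small [e] satisfy a property that holds near [0+], together with
    the first-order expansion of all rates up to [eta * e]. *)
Lemma rates_near (P : R -> Prop) : (\forall e \near (0^'+)%classic, P e) ->
  forall eta d : R, 0 < eta -> 0 < d -> exists e, [/\ 0 < e, e < d, P e &
    forall i, `|lam e i - (Lam i - gam i * e)| <= eta * e].
Proof.
case: HT => _ [_ lamE] _ _ _ nP eta d eta0 d0.
have near_i : \forall e \near (0^'+)%classic,
    forall i, `|lam e i - (Lam i - gam i * e)| <= eta * `|e|.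
  apply: filter_forall => i.
  have fE : lam ^~ i =
      (fun e => Lam i - gam i * e) +o_ (((0 : R)^'+)%classic) (@id R).
    apply/funext => e; exact: lamE.
  by move/eqaddoP: fE => /(_ _ eta0).
have Fp : ProperFilter ((0 : R)^'+)%classic := at_right_proper_filter 0.
have nI := @filterI _ _ Fp _ _ near_i (@filterI _ _ Fp _ _ nP
  (@filterI _ _ Fp _ _ (nbhs_right_gt 0) (nbhs_right_lt d0))).
have [e [ne [Pe [e0 ed]]]] := @filter_ex _ _ Fp _ nI.
by exists e; split=> // i; have := ne i; rewrite (gtr0_norm e0).
Qed.

(** A class without compatible server would have rate identically 0, which the
    heavy-traffic expansion excludes: [gam i < 0] when [Lam i = 0]. *)
Lemma served_class i : exists j, M i j.
Proof.
apply: contrapT => ns.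
have lam0 : forall e, 0 < e < ep -> lam e i = 0.
  by apply: (proj2 adm) => j; apply/negP => Mij; apply: ns; exists j.
have [[ep0 _] [Lam0 _] _ _ gamlt] := HT.
have nT : \forall e \near ((0 : R)^'+)%classic, True by exact: nearW.
have [Li|Li] := eqVneq (Lam i) 0.
  have gi := gamlt _ Li.
  have [|e [e0 eep _ /(_ i)]] := rates_near _ nT (- gam i / 2) ep _ ep0.
    by lra.
  rewrite lam0 ?e0 // Li ler_norml; nra.
have {}Li : 0 < Lam i by rewrite lt_def Li Lam0.
have g1 : 0 < `|gam i| + 1 by rewrite ltr_wpDl.
have d0 : 0 < Num.min ep (Lam i / (`|gam i| + 1)) by rewrite lt_min ep0 divr_gt0.
have [e [e0 + _ /(_ i)]] := rates_near _ nT 1 _ ltr01 d0.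
rewrite lt_min ltr_pdivlMr // => /andP[eep eL].
rewrite lam0 ?e0 // ler_norml.
have := ler_norm (gam i); nra.
Qed.

Lemma captive0 : captive M set0 = set0.
Proof.
apply/setP => i; rewrite in_set0; apply/captiveP => h.
by have [j /h] := served_class i; rewrite in_set0.
Qed.

(** The admissibility bound with the slack expanded and the error terms of all
    classes collected in [eta * e]. *)
Lemma slack_near (S : {set 'I_m}) : S != set0 ->
  exists2 c : R, 0 < c & forall eta d : R, 0 < eta -> 0 < d -> exists e,
    [/\ 0 < e, e < d & c * e <= \sum_(j in S) mu j - \sum_(i in captive M S) Lam i
        + (\sum_(i in captive M S) gam i) * e + eta * e].
Proof.
move=> S0; have [c c0 nc] := proj1 adm S S0; exists c => // eta d eta0 d0.
have n1 : 0 < n.+1%:R :> R by rewrite ltr0n.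
have eta1 : 0 < eta / n.+1%:R by rewrite divr_gt0.
have [e [e0 ed sl er]] := rates_near _ nc _ _ eta1 d0.
exists e; split=> //; apply: (le_trans sl).
have : \sum_(i in captive M S) (Lam i - gam i * e - lam e i) <= eta * e.
  apply: (@le_trans _ _ (\sum_(i in captive M S) (eta / n.+1%:R * e))).
    by apply: ler_sum => i _; rewrite -opprB lerNl; have /lerNnormlW := er i.
  rewrite sumr_const.
  have -> : eta * e = (eta / n.+1%:R * e) *+ n.+1.
    by rewrite -mulr_natr mulrAC divfK // gt_eqF.
  apply: ler_wpMn2l; first by rewrite mulr_ge0 // ltW.
  by rewrite (leq_trans (max_card _)) // card_ord.
by rewrite !sumrB -mulr_suml /slack; lra.
Qed.

(** Were the limiting slack negative, the expansion would contradict
    admissibility at small [e]. *)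
Lemma hall_limit : hall M Lam mu.
Proof.
move=> S; have [->|S0] := eqVneq S set0; first by rewrite captive0 !big_set0.
have [c c0 nc] := slack_near _ S0.
rewrite leNgt; apply/negP => lt.
set L := \sum_(i in _) Lam i in lt nc; set B := \sum_(j in S) mu j in lt nc.
set g := \sum_(i in _) gam i in nc.
have g1 : 0 < `|g| + 1 by rewrite ltr_wpDl.
have [|e [e0]] := nc 1 ((L - B) / (`|g| + 1)) ltr01.
  by rewrite divr_gt0 ?subr_gt0.
rewrite ltr_pdivlMr //.
have := ler_norm g; nra.
Qed.

(** When the limiting slack of [S] vanishes, the first-order term must make up for
    the linear lower bound in the admissibility condition. *)
Lemma gam_captive_gt0 (S : {set 'I_m}) : S != set0 ->
  \sum_(j in S) mu j = \sum_(i in captive M S) Lam i ->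
  0 < \sum_(i in captive M S) gam i.
Proof.
move=> /slack_near[c c0 nc] tight.
have [|e [e0 _]] := nc (c / 2) 1 _ ltr01; first by rewrite divr_gt0.
rewrite tight subrr add0r -mulrDl ler_pM2r //; lra.
Qed.

End Limits.

(** * Relations on finite types *)

Section Relations.
Import mathcomp.boot.fintype mathcomp.boot.finset.
Local Open Scope set_scope.

Lemma connect_closed (T : finType) (e : rel T) (P : T -> Prop) :
  (forall x y, e x y -> P x -> P y) ->
  forall x y, connect e x y -> P x -> P y.
Proof.
move=> eP x y /connectP[p]; elim: p x => [|z p IH] x /=; first by move=> _ ->.
by case/andP=> /eP xz /IH{}IH /IH{}IH /xz /IH.
Qed.

Lemma bip_rel_sym (n m : nat) (M : 'M[bool]_(n, m)) : symmetric (bip_rel M).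
Proof. by move=> [i|j] [i'|j']. Qed.

(** Order the elements by their number of predecessors, breaking ties by their
    index; the position of [x] is its rank in this order. *)
Lemma topological_sort (N : nat) (r : rel 'I_N) :
  irreflexive r -> transitive r ->
  exists s : {perm 'I_N}, forall x y, r x y -> ((s^-1)%g x < (s^-1)%g y)%N.
Proof.
move=> irr tr.
pose p x := #|[set y | r y x]|.
pose q (x : 'I_N) := (p x * N + x)%N.
have pq x y : (p x < p y)%N -> (q x < q y)%N.
  move=> pxy; have : (q x < (p x).+1 * N)%N by rewrite /q mulSn addnC ltn_add2r.
  move/leq_trans; apply; apply: leq_trans (leq_addr _ _).
  by rewrite leq_mul2r pxy orbT.
have q_inj x y : q x = q y -> x = y.
  case: (ltngtP (p x) (p y)) => [/pq|/pq|e]; try by move=> + e; rewrite e ltnn.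
  by rewrite /q e => /addnI /val_inj.
have rq x y : r x y -> (q x < q y)%N.
  move=> rxy; apply: pq; apply: proper_card; apply/properP; split.
    by apply/subsetP => z; rewrite !inE => /tr; apply.
  by exists x; rewrite !inE ?irr.
have rk_lt x : (#|[set y | (q y < q x)%N]| < N)%N.
  rewrite -[X in (_ < X)%N]card_ord -cardsT; apply: proper_card.
  by apply/properP; split; [exact: subsetT | exists x; rewrite !inE ?ltnn].
pose rk x := Ordinal (rk_lt x).
have rk_mono x y : (q x < q y)%N -> (rk x < rk y)%N.
  move=> qxy; apply: proper_card; apply/properP; split.
    by apply/subsetP => z; rewrite !inE => /ltn_trans; apply.
  by exists x; rewrite !inE ?ltnn.
have rk_inj : injective rk.
  move=> x y e; apply: q_inj; case: (ltngtP (q x) (q y)) => // /rk_mono;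
  by rewrite e ltnn.
exists (perm rk_inj)^-1%g => x y rxy.
by rewrite invgK !permE rk_mono // rq.
Qed.

(** Moreover any set [X] closed under predecessors can be listed first: putting
    [X] before its complement keeps the relation a strict order. *)
Lemma topological_sort_prefix (N : nat) (r : rel 'I_N) (X : pred 'I_N) :
  irreflexive r -> transitive r -> (forall x y, r x y -> X y -> X x) ->
  exists s : {perm 'I_N},
    (forall x y, r x y -> ((s^-1)%g x < (s^-1)%g y)%N) /\
    (forall x y, X x -> ~~ X y -> ((s^-1)%g x < (s^-1)%g y)%N).
Proof.
move=> irr tr Xr.
have [||s sP] := @topological_sort N (fun x y => r x y || (X x && ~~ X y)).
- by move=> x; rewrite irr andbN.
- move=> y x z /= /orP[xy|/andP[Xx Xy]] /orP[yz|/andP[Xy' Xz]].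
  + by rewrite (tr _ _ _ xy yz).
  + by rewrite (Xr _ _ xy Xy') Xz orbT.
  + by rewrite Xx (contraNN (Xr _ _ yz) Xy) orbT.
  + by rewrite Xy' in Xy.
exists s; split=> x y h; first by apply: sP; rewrite h.
by move=> Xy; apply: sP; rewrite h Xy orbT.
Qed.

End Relations.

(** * The CRP components *)

Section Components.
Import mathcomp.boot.fintype mathcomp.boot.finset.
Local Open Scope set_scope.

Variables (R : realType) (n m K : nat).
Variables (mu : 'I_m -> R) (Lam : 'I_n -> R) (M : 'M[bool]_(n, m)).
Variable comp : 'I_K -> {set 'I_n + 'I_m}.
Local Notation res := (residual_matching mu Lam M).

(** The components are the fibres of a map [cv] from vertices to indices, and two
    vertices have the same index iff they are connected in the residual graph. *)
Lemma comp_index : crp_indexing mu Lam M comp ->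
  exists cv : 'I_n + 'I_m -> 'I_K,
    [/\ forall v k, (v \in comp k) = (cv v == k),
        forall k, exists v, cv v = k &
        forall u v, (cv u == cv v) = connect (bip_rel res) u v].
Proof.
move=> [inj im _].
have eqR : {in [set: 'I_n + 'I_m] & &, equivalence_rel (connect (bip_rel res))}.
  move=> x y z _ _ _; split=> // xy.
  exact: (same_connect (sym_connect_sym (bip_rel_sym _ _ _))).
have PP := equivalence_partitionP eqR.
have pbE := pblock_equivalence_partition eqR.
rewrite -/(crp_components mu Lam M) -im in PP pbE.
have cvr v : v \in cover [set comp k | k : 'I_K] by rewrite (cover_partition PP).
have ex v : exists k, pblock [set comp k | k : 'I_K] v = comp k.
  by have /imsetP[k _ ->] := pblock_mem (cvr v); exists k.
have [cv cvE] := boolp.choice ex.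
have memE v k : (v \in comp k) = (cv v == k).
  apply/idP/eqP => [vk|<-]; last by rewrite -cvE mem_pblock.
  have [_ tr _] := and3P PP.
  apply: inj; rewrite -cvE (def_pblock tr _ vk) //.
  by apply/imsetP; exists k.
exists cv; split=> // [k|u v].
  have [_ _ n0] := and3P PP.
  have /set0Pn[v] : comp k != set0.
    by apply: contraNneq n0 => <-; apply/imsetP; exists k.
  by rewrite memE => /eqP <-; exists v.
by rewrite -pbE ?in_setT // cvE memE eq_sym.
Qed.

Hypothesis mu_gt0 : forall j, 0 < mu j.
Hypothesis Lam_ge0 : forall i, 0 <= Lam i.
Hypothesis total : \sum_i Lam i = \sum_j mu j.
Hypothesis hallM : hall M Lam mu.
Variable cv : 'I_n + 'I_m -> 'I_K.
Hypothesis cvE : forall v k, (v \in comp k) = (cv v == k).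
Hypothesis cv_connect : forall u v, (cv u == cv v) = connect (bip_rel res) u v.

(** Since the total rates agree, every feasible flow uses all the capacity. *)
Lemma flow_full f : feasible_flow mu Lam M f -> forall j, \sum_i f i j = mu j.
Proof.
move=> [f0 col row _] j; apply/esym/eqP; rewrite -subr_eq0; apply/eqP.
apply: (@psumr_eq0P _ _ predT (fun j => mu j - \sum_i f i j)) => //.
  by move=> k _; rewrite subr_ge0.
rewrite sumrB exchange_big /= -total.
by under [X in _ - X]eq_bigr do rewrite row; rewrite subrr.
Qed.

Lemma flow_exists : exists f, feasible_flow mu Lam M f.
Proof. by apply: hall_flow => // j; apply: ltW. Qed.

Lemma residualP i j :
  reflect (exists2 f, feasible_flow mu Lam M f & 0 < f i j) (res i j).
Proof. by rewrite mxE; apply: asboolP. Qed.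

Lemma residual_cv i j : res i j -> cv (inl i) = cv (inr j).
Proof. by move=> rij; apply/eqP; rewrite cv_connect; apply: connect1. Qed.

Lemma residual_sub i j : res i j -> M i j.
Proof.
move=> /residualP[f [_ _ _ z] fij]; apply: contraLR fij => /z ->.
by rewrite ltxx.
Qed.

Lemma residual_Lam_gt0 i j : res i j -> 0 < Lam i.
Proof.
move=> /residualP[f [f0 _ row _] fij]; rewrite -(row i) (bigD1 j) //=.
by rewrite ltr_wpDr ?sumr_ge0.
Qed.

Lemma Lam_gt0_residual i : 0 < Lam i -> exists j, res i j.
Proof.
move=> Li; have [f fF] := flow_exists; have [f0 _ row _] := fF.
apply: contrapT => nj; suff : \sum_j f i j <= 0 by rewrite row leNgt Li.
apply: sumr_le0 => j _; rewrite leNgt; apply/negP => fij.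
by apply: nj; exists j; apply/residualP; exists f.
Qed.

Lemma server_residual j : exists i, res i j.
Proof.
have [f fF] := flow_exists.
apply: contrapT => ni; suff : \sum_i f i j <= 0 by rewrite flow_full // leNgt mu_gt0.
apply: sumr_le0 => i _; rewrite leNgt; apply/negP => fij.
by apply: ni; exists i; apply/residualP; exists f.
Qed.

Lemma in_I0 k : (k \in I0 Lam comp) = [forall i, (cv (inl i) == k) ==> (Lam i == 0)].
Proof.
rewrite inE /comp_sum psumr_eq0 //; apply/allP/forallP => [h i|h i _].
  by have := h i (mem_index_enum _); rewrite inE cvE.
by rewrite inE cvE.
Qed.

Lemma class_notin_I0 i : 0 < Lam i -> cv (inl i) \notin I0 Lam comp.
Proof.
move=> Li; rewrite in_I0; apply/negP => /forallP/(_ i).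
by rewrite eqxx /= gt_eqF.
Qed.

Lemma server_notin_I0 j : cv (inr j) \notin I0 Lam comp.
Proof.
have [i rij] := server_residual j.
by rewrite -(residual_cv _ _ rij) class_notin_I0 // (residual_Lam_gt0 _ _ rij).
Qed.

Lemma notin_I0_server k : k \notin I0 Lam comp -> exists j, cv (inr j) = k.
Proof.
rewrite in_I0 negb_forall => /existsP[i]; rewrite negb_imply => /andP[/eqP <- Li].
have [|j rij] := Lam_gt0_residual i; first by rewrite lt_def Li Lam_ge0.
by exists j; rewrite (residual_cv _ _ rij).
Qed.

(** The first edge of a nontrivial path from a class is a residual edge. *)
Lemma class_connect i v : cv (inl i) = cv v -> v = inl i \/ exists j, res i j.
Proof.
move=> /eqP; rewrite cv_connect => /connectP[[|[i'|j] p] /=].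
- by move=> _ ->; left.
- by [].
- by case/andP=> rij _ _; right; exists j.
Qed.

Lemma notin_I0_residual i : cv (inl i) \notin I0 Lam comp -> exists j, res i j.
Proof.
by move=> /notin_I0_server[j /esym/class_connect[]].
Qed.

Lemma I0_singleton i i' : cv (inl i) \in I0 Lam comp ->
  cv (inl i) = cv (inl i') -> i' = i.
Proof.
move=> iI /class_connect[[]//|[j rij]].
by move: iI; rewrite (residual_cv _ _ rij) (negPf (server_notin_I0 _)).
Qed.

Lemma I0_class k : k \in I0 Lam comp -> (exists v, cv v = k) ->
  exists i, cv (inl i) = k.
Proof.
move=> kI [[i|j] e]; first by exists i.
by move: kI; rewrite -e (negPf (server_notin_I0 _)).
Qed.

(** Feasible flows do not cross components, so capacity and limiting rate agree on
    any union of components. *)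
Lemma balance (X : pred 'I_K) :
  \sum_(j | X (cv (inr j))) mu j = \sum_(i | X (cv (inl i))) Lam i.
Proof.
have [f fF] := flow_exists; have [f0 _ row _] := fF.
under eq_bigr do rewrite -(flow_full _ fF).
under [RHS]eq_bigr do rewrite -row.
rewrite exchange_big /= [RHS]big_mkcond /=; apply: eq_bigr => i _.
have fcv j : f i j != 0 -> cv (inl i) = cv (inr j).
  by move=> fij; apply: residual_cv; apply/residualP; exists f => //;
    rewrite lt_def fij f0.
case: ifPn => Xi.
  rewrite big_mkcond; apply: eq_bigr => j _; case: ifPn => // Xj.
  by apply/esym/eqP; apply: contraNT Xj => /fcv <-.
rewrite big1 // => j Xj; apply/eqP; apply: contraNT Xi => /fcv ->; exact: Xj.
Qed.

(** A set of servers for which Hall's condition holds with equality. *)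
Definition tight (S : {set 'I_m}) :=
  \sum_(j in S) mu j = \sum_(i in captive M S) Lam i.

(** Every feasible flow fills a tight set from its captive classes alone. *)
Lemma tight_residual S i j : tight S -> j \in S -> res i j -> i \in captive M S.
Proof.
move=> tS jS /residualP[f fF fij]; have [f0 _ row z] := fF.
apply: contraLR fij => iS; rewrite -leNgt.
have : \sum_(i in ~: captive M S) \sum_(j in S) f i j = 0.
  have := tS; rewrite /tight.
  under eq_bigr do rewrite -(flow_full _ fF).
  rewrite exchange_big /= (bigID (mem (captive M S))) /=.
  have -> : \sum_(i in captive M S) Lam i =
      \sum_(i in captive M S) \sum_(j in S) f i j.
    apply: eq_bigr => k /captiveP kS; rewrite -row [LHS](bigID (mem S)) /=.
    rewrite [X in _ + X]big1 ?addr0 // => l lS.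
    by apply: z; apply: contraNN lS => /kS.
  move/(canRL (addKr _)); rewrite addNr => out0; rewrite -[RHS]out0.
  by apply: eq_bigl => k; rewrite in_setC.
move/psumr_eq0P => h0.
have fi0 : \sum_(j in S) f i j = 0.
  by apply: h0; rewrite ?in_setC // => k _; apply: sumr_ge0.
by rewrite (psumr_eq0P _ fi0).
Qed.

(** The sets that contain [j] without capturing [i] have positive slack, so a
    little flow can be reserved for the pair [(i, j)] without breaking Hall's
    condition; the rest is shipped by [hall_flow]. *)
Lemma residual_of_tight i j : M i j -> 0 < Lam i ->
  (forall S, tight S -> j \in S -> i \in captive M S) -> res i j.
Proof.
move=> Mij Li tS.
pose P (S : {set 'I_m}) := (j \in S) && (i \notin captive M S).
pose F (S : {set 'I_m}) := \sum_(j in S) mu j - \sum_(i in captive M S) Lam i.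
have [d [dx dF dE]] := exists_maximal_bound _ _ P F (Num.min (Lam i) (mu j)).
have [da db] : d <= Lam i /\ d <= mu j by move: dx; rewrite le_min => /andP.
have d0 : 0 < d.
  case: dE => [->|[S /andP[jS iS] ->]]; first by rewrite lt_min Li mu_gt0.
  rewrite lt_def subr_ge0 hallM andbT subr_eq0.
  by apply: contraNN iS => /eqP tSS; apply: tS.
pose a' k := Lam k - (if k == i then d else 0).
pose b' k := mu k - (if k == j then d else 0).
have [|||f ff] := hall_flow _ _ _ M a' b'.
- by move=> k; rewrite subr_ge0; case: eqP => // ->.
- by move=> k; rewrite subr_ge0; case: eqP => [->|_] //; apply: ltW.
- move=> S; rewrite !sum_sub_delta.
  have HS := hallM S; have := dF S; rewrite /P /F.
  by case: (j \in S); case: (i \in captive M S) => /= h;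
     try (have {}h := h isT); lra.
apply/residualP; exists (f + \matrix_(k, l) if (k == i) && (l == j) then d else 0).
  apply: feasible_flow_ext (feasible_flowD _ _ _ _ _ _ _ _ _ _ ff
    (feasible_flow_delta _ _ _ _ _ _ _ (ltW d0) Mij)).
    by move=> k; rewrite subrK.
  by move=> k; rewrite subrK.
have [f0 _ _ _] := ff.
by rewrite !mxE !eqxx ltr_wpDl.
Qed.

(** The vertices attached to a set [S] of servers: [S] itself and the classes
    captive in it. *)
Definition inside (S : {set 'I_m}) (v : 'I_n + 'I_m) : bool :=
  match v with inl i => i \in captive M S | inr j => j \in S end.

Lemma tight_component S u v : tight S -> cv u = cv v -> inside S u -> inside S v.
Proof.
move=> tS /eqP; rewrite cv_connect; move: u v; apply: connect_closed.
move=> [i|j] [i'|j'] //= rij.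
  by move/captiveP; apply; apply: residual_sub.
by move=> jS; apply: tight_residual rij.
Qed.

Lemma dag_arcP k1 k2 : reflect
  (k1 <> k2 /\ exists i j, [/\ cv (inl i) = k1, cv (inr j) = k2 & M i j])
  (dag_arc M comp k1 k2).
Proof.
apply: (iffP andP) => -[/eqP k12]; last first.
  case=> i [j [ik jk Mij]]; split=> //; apply/existsP; exists i.
  rewrite inE cvE ik eqxx; apply/existsP; exists j.
  by rewrite inE cvE jk eqxx.
move=> /existsP[i /andP[]]; rewrite inE cvE => /eqP ik.
move=> /existsP[j /andP[]]; rewrite inE cvE => /eqP jk Mij.
by split=> //; exists i, j.
Qed.

Lemma arc_notin_I0 k1 k2 : dag_arc M comp k1 k2 -> k2 \notin I0 Lam comp.
Proof. by move=> /dag_arcP[_ [i [j [_ <- _]]]]; apply: server_notin_I0. Qed.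

Lemma dpath_notin_I0 k1 k2 : dpath M comp k1 k2 -> k2 \notin I0 Lam comp.
Proof.
move=> /existsP[k /andP[/arc_notin_I0 a]] kk; move: k k2 kk a.
by apply: connect_closed => x y /arc_notin_I0.
Qed.

Lemma arc_dpath k1 k2 : dag_arc M comp k1 k2 -> dpath M comp k1 k2.
Proof. by move=> a; apply/existsP; exists k2; rewrite a connect0. Qed.

Lemma dpath_trans : transitive (dpath M comp).
Proof.
move=> b a c /existsP[x /andP[ax xb]] /existsP[y /andP[yb yc]].
apply/existsP; exists x; rewrite ax.
exact: connect_trans xb (connect_trans (connect1 yb) yc).
Qed.

Lemma connect_dpath k1 k2 : connect (dag_arc M comp) k1 k2 ->
  k1 = k2 \/ dpath M comp k1 k2.
Proof.
move=> /connectP[[|x p] /=]; first by left.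
case/andP=> a px ->; right; apply/existsP; exists x; rewrite a.
by apply/connectP; exists p.
Qed.

(** The components inside a tight set are closed under paths of the DAG. *)
Lemma tight_connect S k1 k2 : tight S -> connect (dag_arc M comp) k1 k2 ->
  (forall v, cv v = k1 -> inside S v) -> forall v, cv v = k2 -> inside S v.
Proof.
move=> tS; move: k1 k2.
apply: connect_closed => k1 k2 /dag_arcP[_ [i [j [ik jk Mij]]]] h v vk.
apply: (tight_component S (inr j)) => //; first by rewrite jk.
by have /captiveP := h _ ik; apply.
Qed.

(** An arc from class [i] to server [j] on a cycle: a tight set containing [j]
    contains the whole component of [j], then by [tight_connect] that of [i], so
    [(i, j)] is a residual edge. *)
Lemma dpath_irr : irreflexive (dpath M comp).
Proof.
move=> k; apply/negbTE/negP => kk; have kI := dpath_notin_I0 _ _ kk.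
move: kk => /existsP[k' /andP[/dag_arcP[kk' [i [j [ik jk Mij]]]] k'k]].
apply: kk'; rewrite -ik -jk; apply: residual_cv; apply: residual_of_tight => //.
  have [|l /residual_Lam_gt0 //] := notin_I0_residual i; by rewrite ik.
move=> S tS jS; apply: (tight_connect _ _ _ tS k'k _ (inl i)) => // v vk'.
by apply: (tight_component S (inr j)) => //; rewrite jk.
Qed.

(** * Topological orders and positions *)

Variable gam : 'I_n -> R.
Hypothesis cv_onto : forall k, exists v, cv v = k.
Hypothesis notin_I0E : forall k, (k \notin I0 Lam comp) = (k < K' Lam comp)%N.
Hypothesis servedM : forall i, exists j, M i j.
Hypothesis gam_gt0 : forall S, S != set0 -> tight S ->
  0 < \sum_(i in captive M S) gam i.
Local Notation N := (K' Lam comp).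

Lemma emb_notin_I0 (x : 'I_N) : emb x \notin I0 Lam comp.
Proof. by rewrite notin_I0E /= ltn_ord. Qed.

Lemma emb_onto k : k \notin I0 Lam comp -> exists x : 'I_N, emb x = k.
Proof.
by rewrite notin_I0E => kN; exists (Ordinal kN); apply: val_inj.
Qed.

Lemma emb_inj : injective (@emb R n m K Lam comp).
Proof. by move=> x y [] /val_inj. Qed.

Lemma topo_ordersP (s : {perm 'I_N}) : reflect
  (forall x y, dpath M comp (emb x) (emb y) -> ((s^-1)%g y < (s^-1)%g x)%N)
  (s \in topo_orders Lam M comp).
Proof.
rewrite inE; apply: (iffP forallP) => [h x y|h x].
  by move/forallP: (h x) => /(_ y)/implyP.
by apply/forallP => y; apply/implyP => /h.
Qed.

(** A set of components closed under reachability can be listed first. *)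
Lemma topo_exists_prefix (X : pred 'I_N) :
  (forall x y, dpath M comp (emb x) (emb y) -> X x -> X y) ->
  exists2 s, s \in topo_orders Lam M comp &
    forall x y, X x -> ~~ X y -> ((s^-1)%g x < (s^-1)%g y)%N.
Proof.
move=> Xd.
have [|||s [sr sX]] :=
    @topological_sort_prefix _ (fun x y => dpath M comp (emb y) (emb x)) X.
- by move=> x; apply: dpath_irr.
- by move=> y x z yx zy; apply: dpath_trans zy yx.
- by move=> x y; apply: Xd.
by exists s => //; apply/topo_ordersP => x y; apply: sr.
Qed.

Lemma I0_reaches k : k \in I0 Lam comp -> exists x : 'I_N, dpath M comp k (emb x).
Proof.
move=> kI; have [i ik] := I0_class _ kI (cv_onto k).
have [j Mij] := servedM i; have jI := server_notin_I0 j.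
have [x xE] := emb_onto _ jI; exists x; rewrite xE.
apply: arc_dpath; apply/dag_arcP; split; last by exists i, j.
by move=> kE; move: kI; rewrite kE (negPf jI).
Qed.

Lemma mem_comps (s : {perm 'I_N}) k l : (k \in comps M s l) =
  (k == emb (s l)) || [&& k \in I0 Lam comp, dpath M comp k (emb (s l)) &
       [forall l', dpath M comp k (emb (s l')) ==> (l' <= l)%N]].
Proof. by rewrite /comps in_setU1 inE. Qed.

(** The blocks [comps M s l] partition the components: [pos k] is the position of
    the block of [k], which for [k] in [I0] is the largest position that [k]
    reaches. *)
Lemma pos_exists (s : {perm 'I_N}) :
  exists pos : 'I_K -> 'I_N, forall k l, (k \in comps M s l) = (pos k == l).
Proof.
suff ex k : exists p, forall l, (k \in comps M s l) = (p == l).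
  by have [pos posE] := boolp.choice ex; exists pos.
have [kI|kI] := boolP (k \in I0 Lam comp); last first.
  have [x <-] := emb_onto _ kI; exists ((s^-1)%g x) => l.
  rewrite mem_comps (negPf (emb_notin_I0 x)) orbF.
  apply/eqP/eqP => [/emb_inj ->|<-]; last by rewrite permKV.
  by rewrite permK.
have [x kx] := I0_reaches _ kI.
rewrite -[x](permKV s) in kx.
pose P l := dpath M comp k (emb (s l)).
case: (@arg_maxnP _ _ P (fun l : 'I_N => l : nat) kx) => p Pp pmax.
exists p => l; rewrite mem_comps kI /=.
have -> /= : (k == emb (s l)) = false.
  by apply/negbTE; apply: contraTneq kI => ->; apply: emb_notin_I0.
apply/andP/eqP => [[kl /forallP lmax]|<-].
  have lp : (l <= p)%N := pmax _ kl.
  apply/val_inj/anti_leq; rewrite lp andbT.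
  by have /implyP := lmax p; apply.
by split=> //; apply/forallP => l'; apply/implyP; apply: pmax.
Qed.

Section Order.
Variables (s : {perm 'I_N}) (pos : 'I_K -> 'I_N).
Hypothesis topo_s : s \in topo_orders Lam M comp.
Hypothesis posE : forall k l, (k \in comps M s l) = (pos k == l).

Lemma pos_emb x : pos (emb x) = (s^-1)%g x.
Proof. by apply/eqP; rewrite -posE mem_comps permKV eqxx. Qed.

Lemma posP k : k = emb (s (pos k)) \/ dpath M comp k (emb (s (pos k))).
Proof.
have := eqxx (pos k); rewrite -posE mem_comps.
by case/orP => [/eqP|/and3P[]]; [left | right].
Qed.

(** For [k] in [I0] this is the maximality in the definition of the blocks. *)
Lemma pos_dpath k k' : dpath M comp k k' -> (pos k' <= pos k)%N.
Proof.
move=> kk'; have [x xE] := emb_onto _ (dpath_notin_I0 _ _ kk').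
rewrite -xE pos_emb; rewrite -xE in kk'.
have [kI|kI] := boolP (k \in I0 Lam comp); last first.
  have [y yE] := emb_onto _ kI; rewrite -yE pos_emb.
  by apply: ltnW; apply: (topo_ordersP _ topo_s); rewrite yE.
have := eqxx (pos k); rewrite -posE mem_comps.
case/orP => [/eqP kE|/and3P[_ _ /forallP/(_ ((s^-1)%g x))]].
  by move: kI; rewrite kE (negPf (emb_notin_I0 _)).
by rewrite permKV kk'.
Qed.

(** The classes captive in the servers of the first blocks are the classes of
    these blocks. *)
Lemma captive_prefix (l : 'I_N) :
  captive M [set j | (pos (cv (inr j)) <= l)%N] =
  [set i | (pos (cv (inl i)) <= l)%N].
Proof.
apply/setP => i; rewrite [RHS]inE; apply/captiveP/idP => [h|il j Mij]; last first.
  rewrite inE; apply: leq_trans il.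
  have [->//|ij] := eqVneq (cv (inl i)) (cv (inr j)).
  by apply/pos_dpath/arc_dpath/dag_arcP; split; [apply/eqP | exists i, j].
have [iI|iI] := boolP (cv (inl i) \in I0 Lam comp); last first.
  have [j rij] := notin_I0_residual _ iI.
  by have := h j (residual_sub _ _ rij); rewrite inE (residual_cv _ _ rij).
(* Every path out of an isolated class starts with an arc to a server
   compatible with that class, hence to a component in the prefix; topological
   order keeps the rest of the path there. *)
case: (posP (cv (inl i))) => [e|].
  by move: iI; rewrite {1}e (negPf (emb_notin_I0 _)).
set p := pos (cv (inl i)).
case/existsP=> k /andP[/dag_arcP[_ [i' [j [i'E jk Mij]]]] kp].
have {}i'E : i' = i by apply: I0_singleton.
rewrite i'E in Mij; have := h _ Mij; rewrite inE jk; apply: leq_trans.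
have -> : p = pos (emb (s p)) by rewrite pos_emb permK.
by case: (connect_dpath _ _ kp) => [->|/pos_dpath].
Qed.

Lemma gam_partialE l :
  gam_partial gam M s l = \sum_(i | (pos (cv (inl i)) <= l)%N) gam i.
Proof.
rewrite /gam_partial.
rewrite [RHS](partition_big (fun i => pos (cv (inl i))) (fun p => (p <= l)%N)) //=.
apply: eq_bigr => p pl; under eq_bigl do rewrite posE.
rewrite (partition_big (fun i => cv (inl i)) (fun k => pos k == p)) /=; last first.
  by move=> i /andP[].
apply: eq_bigr => k /eqP kp; apply: eq_bigl => i.
by rewrite inE cvE; case: eqP => [->|//]; rewrite ?kp ?pl ?eqxx ?andbF.
Qed.

Lemma gam_partial_gt0 l : 0 < gam_partial gam M s l.
Proof.
pose S := [set j | (pos (cv (inr j)) <= l)%N].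
rewrite gam_partialE.
have cE := captive_prefix l; rewrite -/S in cE.
have -> : \sum_(i | (pos (cv (inl i)) <= l)%N) gam i = \sum_(i in captive M S) gam i.
  by rewrite cE; apply: eq_bigl => i; rewrite inE.
apply: gam_gt0.
  have [j jE] := notin_I0_server _ (emb_notin_I0 (s l)).
  by apply/set0Pn; exists j; rewrite inE jE pos_emb permK.
rewrite /tight cE; under eq_bigl do rewrite inE.
under [RHS]eq_bigl do rewrite inE.
exact: (balance (fun k => (pos k <= l)%N)).
Qed.

Lemma Qsigma_gt0 : 0 < Qsigma gam M s.
Proof. by apply: prodr_gt0 => l _; rewrite divr_gt0 ?gam_partial_gt0. Qed.

Variable last : 'I_N.
Hypothesis lastP : forall x : 'I_N, (x <= last)%N.

Lemma gam_partial_last : gam_partial gam M s last = \sum_i gam i.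
Proof. by rewrite gam_partialE; apply: eq_bigl => i; rewrite lastP. Qed.

(** The last position is singled out: it contributes to every component. *)
Lemma wsigmaE k : wsigma gam M s k =
  1 / \sum_i gam i +
  \sum_(l : 'I_N | (pos k <= l)%N && (l != last)) 1 / gam_partial gam M s l.
Proof.
rewrite /wsigma; have -> : comps_inv M s k = Some (pos k).
  rewrite /comps_inv; case: pickP => [l|/(_ (pos k))]; last by rewrite /= posE eqxx.
  by rewrite posE => /eqP ->.
by rewrite (bigD1 last) ?lastP //= gam_partial_last.
Qed.

Lemma wsigma_ge k : 1 / \sum_i gam i <= wsigma gam M s k.
Proof.
rewrite wsigmaE lerDl; apply: sumr_ge0 => l _.
by rewrite divr_ge0 // ltW // gam_partial_gt0.
Qed.

Lemma wsigma_eq k : (wsigma gam M s k == 1 / \sum_i gam i) = (pos k == last).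
Proof.
rewrite wsigmaE -subr_eq0 addrC addKr psumr_eq0; last first.
  by move=> l _; rewrite divr_ge0 // ltW // gam_partial_gt0.
apply/allP/eqP => [h|-> l _].
  apply/eqP; rewrite -[_ == _]negbK; apply/negP => kl.
  have := h (pos k) (mem_index_enum _); rewrite leqnn kl /=.
  by rewrite gt_eqF // divr_gt0 ?gam_partial_gt0.
apply/implyP => /andP[ll] /eqP[].
by apply/val_inj/anti_leq; rewrite ll lastP.
Qed.

Lemma pos_last_of_reach k :
  (forall kap, kap != k -> kap \notin I0 Lam comp -> dpath M comp k kap) ->
  pos k = last.
Proof.
move=> h; have [kE|kE] := eqVneq (emb (s last)) k.
  by rewrite -kE pos_emb permK.
apply/val_inj/anti_leq; rewrite lastP /=.
have /pos_dpath := h _ kE (emb_notin_I0 _).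
by rewrite pos_emb permK.
Qed.

End Order.

(** * The averaged waiting times *)

Variable last : 'I_N.
Hypothesis lastP : forall x : 'I_N, (x <= last)%N.
Local Notation Z := (\sum_(s in topo_orders Lam M comp) Qsigma gam M s).

Lemma Qsigma_topo_gt0 s : s \in topo_orders Lam M comp -> 0 < Qsigma gam M s.
Proof. by move=> sT; have [pos posE] := pos_exists s; apply: Qsigma_gt0 posE. Qed.

Lemma sum_Qsigma_gt0 : 0 < Z.
Proof.
have [s sT _] := topo_exists_prefix pred0 (fun _ _ _ h => h).
rewrite (bigD1 s) //= ltr_wpDr ?Qsigma_topo_gt0 //.
by apply: sumr_ge0 => t /andP[/Qsigma_topo_gt0/ltW].
Qed.

(** The weights sum to 1, so the excess over the bound is an average of excesses. *)
Lemma What_sub k : What Lam gam M comp k - 1 / \sum_i gam i =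
  \sum_(s in topo_orders Lam M comp)
    Qsigma gam M s / Z * (wsigma gam M s k - 1 / \sum_i gam i).
Proof.
under [RHS]eq_bigr do rewrite mulrBr.
rewrite sumrB -[X in _ = _ - X]mulr_suml -mulr_suml divff ?mul1r //.
by rewrite gt_eqF // sum_Qsigma_gt0.
Qed.

Lemma What_term_ge0 k s : s \in topo_orders Lam M comp ->
  0 <= Qsigma gam M s / Z * (wsigma gam M s k - 1 / \sum_i gam i).
Proof.
move=> sT; have [pos posE] := pos_exists s.
by rewrite mulr_ge0 ?divr_ge0 ?subr_ge0 ?(wsigma_ge _ _ sT posE _ lastP) // ltW //
   ?Qsigma_topo_gt0 ?sum_Qsigma_gt0.
Qed.

Lemma What_ge k : 1 / \sum_i gam i <= What Lam gam M comp k.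
Proof.
by rewrite -subr_ge0 What_sub; apply: sumr_ge0 => s; apply: What_term_ge0.
Qed.

Lemma What_eqP k : What Lam gam M comp k = 1 / \sum_i gam i <->
  forall s pos, s \in topo_orders Lam M comp ->
    (forall k l, (k \in comps M s l) = (pos k == l)) -> pos k = last.
Proof.
have termE s pos : s \in topo_orders Lam M comp ->
    (forall k l, (k \in comps M s l) = (pos k == l)) ->
    (Qsigma gam M s / Z * (wsigma gam M s k - 1 / \sum_i gam i) == 0) =
    (pos k == last).
  move=> sT posE; rewrite mulf_eq0.
  rewrite gt_eqF ?divr_gt0 ?Qsigma_topo_gt0 ?sum_Qsigma_gt0 //=.
  by rewrite subr_eq0 (wsigma_eq _ _ sT posE _ lastP).
split=> [/eqP|h].
  rewrite -subr_eq0 What_sub psumr_eq0; last by move=> s; apply: What_term_ge0.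
  move=> /allP h s pos sT posE; apply/eqP; rewrite -(termE s) //.
  by have := h s (mem_index_enum _); rewrite sT.
apply/eqP; rewrite -subr_eq0 What_sub big1 // => s sT.
have [pos posE] := pos_exists s.
by apply/eqP; rewrite (termE s pos sT posE); apply/eqP/(h s).
Qed.

Lemma all_last_reach k :
  (forall s pos, s \in topo_orders Lam M comp ->
    (forall k l, (k \in comps M s l) = (pos k == l)) -> pos k = last) <->
  (forall kap, kap != k -> kap \notin I0 Lam comp -> dpath M comp k kap).
Proof.
split=> [h kap kapk kapI|h s pos sT posE]; last first.
  exact: (pos_last_of_reach _ _ sT posE _ lastP).
(* List [k] and the components that it reaches before [kap]: the block of [k]
   then precedes [kap]. *)
apply: contrapT => /negP nk.
pose X (x : 'I_N) := (emb x == k) || dpath M comp k (emb x).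
have [x y xy|s sT sX] := topo_exists_prefix X.
  rewrite /X => /orP[/eqP <-|kx]; first by rewrite xy orbT.
  by rewrite (dpath_trans _ _ _ kx xy) orbT.
have [pos posE] := pos_exists s.
have [y yE] := emb_onto _ kapI.
have Xp : X (s (pos k)).
  by rewrite /X; case: (posP _ _ posE k) => [<-|->]; rewrite ?eqxx ?orbT.
have Xy : ~~ X y by rewrite /X yE (negPf kapk).
have := sX _ _ Xp Xy; rewrite permK (h s pos sT posE).
by rewrite ltnNge lastP.
Qed.

End Components.

(** * The lower bound and its equality case *)

Theorem proposition4 (R : realType) (n m : nat) (ep : R)
    (lam : R -> 'I_n -> R) (mu : 'I_m -> R) (Lam gam : 'I_n -> R)
    (M : 'M[bool]_(n, m)) (K : nat) (comp : 'I_K -> {set 'I_n + 'I_m})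
    (mu_gt0 : forall j, 0 < mu j)
    (HT : heavy_traffic ep lam mu Lam gam)
    (adm : admissible ep lam mu M)
    (crp : crp_indexing mu Lam M comp) :
  (forall k : 'I_K, 1 / \sum_i gam i <= What Lam gam M comp k) /\
  (forall k : 'I_K,
     What Lam gam M comp k = 1 / \sum_i gam i <->
     (forall kap : 'I_K, kap != k -> kap \notin I0 Lam comp ->
        dpath M comp k kap)).
Proof.
have [_ [Lam_ge0 _] total gam_sum_gt0 gam_lt0] := HT.
have served := served_class _ _ _ _ _ _ _ _ _ HT adm.
have hallM := hall_limit _ _ _ _ _ _ _ _ _ HT adm.
have gam_gt0 S : S != finset.set0 -> tight R n m mu Lam M S ->
    0 < \sum_(i in captive M S) gam i.
  exact: gam_captive_gt0 HT adm S.
have [cv [cvE cv_onto cv_connect]] := comp_index _ _ _ _ _ _ _ _ crp.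
have notin_I0E := let: And3 _ _ h := crp in h.
(* otherwise every [gam i] would be negative *)
have [i Li] : exists i, 0 < Lam i.
  apply: contrapT => nL; move: gam_sum_gt0; rewrite ltNge => /negP; apply.
  apply: sumr_le0 => i _; apply/ltW/gam_lt0/eqP; rewrite eq_le Lam_ge0 andbT.
  by rewrite leNgt; apply/negP => Li; apply: nL; exists i.
have : cv (inl i) \notin I0 Lam comp by apply: class_notin_I0.
rewrite notin_I0E => cvi.
have N0 := leq_ltn_trans (leq0n _) cvi.
have lastN : ((K' Lam comp).-1 < K' Lam comp)%N by rewrite prednK.
pose last := Ordinal lastN.
have lastP (x : 'I_(K' Lam comp)) : (x <= last)%N by rewrite -ltnS /= prednK.
split=> k.
  by apply: What_ge lastP k => //; eassumption.
rewrite -(@all_last_reach R n m K mu Lam M comp) //; try eassumption.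
by apply: What_eqP lastP k => //; eassumption.
Qed.
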